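(* For integers $n\ge2$ let $$d_n=\prod_{k=1}^{n}\frac{4(n-1)^4-(8k-6)(n-1)^2+4k^2-6k+2}{n(n-1)(2n-1)^2}.$$ Then $$\lim_{n\to\infty}d_n=\frac1{e^3}.$$ *)

(* Defs.v *)
From HB Require Import structures.
From mathcomp Require Import all_boot all_order all_algebra.
From mathcomp Require Import all_classical all_reals all_analysis.

Set Implicit Arguments.
Unset Strict Implicit.
Unset Printing Implicit Defensive.

Import Order.TTheory GRing.Theory Num.Theory.
Import numFieldNormedType.Exports.

Local Open Scope ring_scope.

(* Meaningful for n >= 2 only: at n = 0, 1 the denominator vanishes, and the
   value given by the total inverse does not affect the limit. All subtractions
   take place in R. *)
Definition d (R : realType) (n : nat) : R :=
  \prod_(1 <= k < n.+1)
    ((4 * (n%:R - 1) ^+ 4 - (8 * k%:R - 6) * (n%:R - 1) ^+ 2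
        + 4 * k%:R ^+ 2 - 6 * k%:R + 2)
     / (n%:R * (n%:R - 1) * (2 * n%:R - 1) ^+ 2)).

(* Main.v *)
Require Import Defs.
From HB Require Import structures.
From mathcomp Require Import all_boot all_order all_algebra.
From mathcomp Require Import all_classical all_reals all_analysis.
From mathcomp Require Import ring lra.

(** Put [x = n - 1].  The [k]-th factor of [d R n] is [1 + u] with
    [u = deviation x k = O(1 / x)], uniformly in [1 <= k <= n].  There are
    [n] factors, so the squares of the deviations add up to [O(1 / x)], and
    at this order [\prod (1 + u)] and [expR (\sum u)] have the same limit
    ([cvg_prod_1D]): logarithms may be replaced by their linear part.

    The deviation is a quadratic polynomial in [k] over a denominator that
    does not depend on [k], so the sums of [1], [k] and [k ^ 2] give
    [\sum u] in closed form ([sum_deviation]):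
      [\sum u = - (36 x ^ 2 + 17 x - 2) / (3 (2 x + 1) ^ 2)],
    which tends to [- 36 / 12 = - 3].  (Heuristically, the denominator of the
    factors contributes [- 2] and the numerator [- 1].) *)

Import Order.TTheory GRing.Theory Num.Theory.
Import numFieldNormedType.Exports.

Local Open Scope ring_scope.
Local Open Scope classical_set_scope.

(** * Products of factors close to one *)

(** The bound [1 + y <= expR y] at [y = - u / (1 + u)] gives
    [expR (u / (1 + u)) <= 1 + u], and
    [u / (1 + u) = u - u ^ 2 / (1 + u) >= u - 2 u ^ 2]. *)
Lemma expR_quadratic_le_1D (R : realType) (u : R) :
  - 2^-1 <= u -> expR (u - 2 * u ^+ 2) <= 1 + u.
Proof.
move=> hu.
have u1 : 0 < 1 + u by lra.
have le_arg : u - 2 * u ^+ 2 <= u / (1 + u).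
  rewrite ler_pdivlMr // -subr_ge0.
  have -> : u - (u - 2 * u ^+ 2) * (1 + u) = u ^+ 2 * (2 * u + 1) by ring.
  by rewrite mulr_ge0 ?sqr_ge0//; lra.
apply: (@le_trans _ _ (expR (u / (1 + u)))); first by rewrite ler_expR.
rewrite -[leLHS]invrK -expRN -[leRHS]invrK lef_pV2 ?posrE ?expR_gt0 ?invr_gt0//.
rewrite [leLHS](_ : _ = 1 + - (u / (1 + u))); last by field; lra.
exact: expR_ge1Dx.
Qed.

Lemma prod_1D_bounds (R : realType) (I : eqType) (r : seq I) (u : I -> R) :
  (forall i, i \in r -> - 2^-1 <= u i) ->
  expR (\sum_(i <- r) u i - 2 * \sum_(i <- r) u i ^+ 2)
    <= \prod_(i <- r) (1 + u i) <= expR (\sum_(i <- r) u i).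
Proof.
move=> hu; apply/andP; split.
  rewrite mulr_sumr -sumrB expR_sum big_seq [leRHS]big_seq.
  apply: ler_prod => i ir; rewrite expR_ge0/=.
  exact: expR_quadratic_le_1D (hu i ir).
rewrite expR_sum big_seq [leRHS]big_seq.
apply: ler_prod => i /hu ui; rewrite expR_ge1Dx andbT; lra.
Qed.

(** No smallness of the individual [u n i] needs to be assumed: each square is
    at most the sum of squares, which is eventually below [1 / 4]. *)
Lemma cvg_prod_1D (R : realType) (I : eqType) (r : nat -> seq I)
    (u : nat -> I -> R) (s : R) :
  (\sum_(i <- r n) u n i) @[n --> \oo] --> s ->
  (\sum_(i <- r n) u n i ^+ 2) @[n --> \oo] --> (0 : R) ->
  (\prod_(i <- r n) (1 + u n i)) @[n --> \oo] --> expR s.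
Proof.
move=> sum_s sq_0.
have sq_small : \forall n \near \oo, \sum_(i <- r n) u n i ^+ 2 < 4^-1.
  by apply: (cvgr_lt _ sq_0); rewrite invr_gt0.
apply: (@squeeze_cvgr _ _ _ _
  (fun n => expR (\sum_(i <- r n) u n i - 2 * \sum_(i <- r n) u n i ^+ 2))
  (fun n => expR (\sum_(i <- r n) u n i))).
- near=> n; apply: prod_1D_bounds => i ir.
  have : u n i ^+ 2 < 4^-1.
    apply: le_lt_trans (near sq_small n _) => //.
    rewrite (big_rem i ir)/= lerDl sumr_ge0// => j _; exact: sqr_ge0.
  by move=> ?; nra.
- apply: continuous_cvg; first exact: continuous_expR.
  rewrite -[s]subr0 -[X in s - X](mulr0 2).
  by apply: cvgB => //; apply: cvgMl_tmp.
- by apply: continuous_cvg; first exact: continuous_expR.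
Unshelve. all: by end_near. Qed.

(** * The deviations of the factors from one *)

Definition deviation {R : realType} (x k : R) : R :=
  (4 * k ^+ 2 - (8 * x ^+ 2 + 6) * k + (2 - x + x ^+ 2 - 8 * x ^+ 3))
  / ((x + 1) * x * (2 * x + 1) ^+ 2).

(** [d] is stated at [n + 2], where [x = n + 1 > 0] and no denominator
    vanishes. *)
Lemma d_deviation (R : realType) (n : nat) :
  d R n.+2 = \prod_(k <- index_iota 1 n.+3) (1 + deviation n.+1%:R k%:R :> R).
Proof.
apply: eq_bigr => k _; rewrite /deviation.
have -> : n.+2%:R = n.+1%:R + 1 :> R by rewrite -natr1.
have x0 : 0 < n.+1%:R :> R by rewrite ltr0n.
by move: (n.+1%:R : R) x0 => x x0; field; apply/and3P; split; apply/eqP; lra.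
Qed.

(** The term [- 8 x ^ 3] of the numerator dominates the positive terms because
    [4 k ^ 2 - 6 k + 2 = (2 k - 1) (2 k - 2) <= (2 x + 1) (2 x)]. *)
Lemma deviation_bounds (R : realType) (x k : R) :
  1 <= x -> 1 <= k <= x + 1 -> - (4 / x) <= deviation x k <= 0.
Proof.
move=> x1 /andP[k1 kx].
have D0 : 0 < (x + 1) * x * (2 * x + 1) ^+ 2.
  by rewrite !mulr_gt0 ?exprn_gt0//; lra.
have x2 : 1 <= x ^+ 2 by rewrite exprn_ege1.
have kk : 0 <= (2 * k - 1) * (2 * k - 2) <= (2 * x + 1) * (2 * x).
  by apply/andP; split; [rewrite mulr_ge0//; lra | apply: ler_pM; lra].
have kx2 : 0 <= x ^+ 2 * (k - 1) by rewrite mulr_ge0; lra.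
have kx2' : 0 <= x ^+ 2 * (x + 1 - k) by rewrite mulr_ge0; lra.
have x3 : 0 <= x ^+ 2 * (x - 1) by rewrite mulr_ge0; lra.
have x3' : 0 <= x * (x - 1) by rewrite mulr_ge0; lra.
rewrite /deviation; apply/andP; split; last first.
  by rewrite ler_pdivrMr// mul0r; move: kk => /andP[]; lra.
rewrite ler_pdivlMr//.
have -> : - (4 / x) * ((x + 1) * x * (2 * x + 1) ^+ 2)
    = - (4 * ((x + 1) * (2 * x + 1) ^+ 2)) by field; lra.
by move: kk => /andP[]; lra.
Qed.

Lemma sum_quadratic (R : realType) (a b c : R) (n : nat) :
  \sum_(k <- index_iota 1 n.+1) (a * k%:R ^+ 2 + b * k%:R + c) =
  a * (n%:R * (n%:R + 1) * (2 * n%:R + 1) / 6) + b * (n%:R * (n%:R + 1) / 2)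
    + c * n%:R.
Proof.
elim: n => [|n IHn]; first by rewrite big_geq//; ring.
by rewrite big_nat_recr//= IHn -natr1; field.
Qed.

Lemma sum_deviation (R : realType) (n : nat) (x := n.+1%:R : R) :
  \sum_(k <- index_iota 1 n.+3) deviation x k%:R =
  - (36 * x ^+ 2 + 17 * x - 2) / (3 * (2 * x + 1) ^+ 2).
Proof.
rewrite -mulr_suml.
under eq_bigr do rewrite -mulNr.
rewrite sum_quadratic.
have -> : n.+2%:R = x + 1 by rewrite -natr1.
have x0 : 0 < x by rewrite ltr0n.
by move: x x0 => x x0; field; apply/and3P; split; apply/eqP; lra.
Qed.

(** With [h = 1 / x] the closed form is continuous at [h = 0]. *)
Lemma cvg_sum_deviation (R : realType) :
  (\sum_(k <- index_iota 1 n.+3) deviation n.+1%:R k%:R) @[n --> \oo]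
    --> (- 3 : R).
Proof.
have h0 := @cvg_harmonic R.
have -> : (fun n => \sum_(k <- index_iota 1 n.+3) deviation n.+1%:R k%:R) =
    (fun n => (- 36 - 17 * harmonic n + 2 * (harmonic n * harmonic n))
     * (3 * ((2 + harmonic n) * (2 + harmonic n)))^-1) :> (nat -> R).
  apply/funext => n; rewrite sum_deviation /harmonic/=.
  have x0 : 0 < n.+1%:R :> R by rewrite ltr0n.
  by move: (n.+1%:R : R) x0 => x x0; field; repeat (apply/andP; split); apply/eqP; lra.
have -> : -3 = (- 36 - 17 * 0 + 2 * (0 * 0)) * (3 * ((2 + 0) * (2 + 0)))^-1 :> R.
  by field.
apply: cvgM.
  apply: cvgD; last by apply: cvgMl_tmp; apply: cvgM.
  by apply: cvgB; [exact: cvg_cst | apply: cvgMl_tmp].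
apply: cvgV; first by apply/eqP; lra.
by apply: cvgMl_tmp; apply: cvgM; apply: cvgD => //; exact: cvg_cst.
Qed.

(** There are [x + 1] terms, each at most [(4 / x) ^ 2]. *)
Lemma cvg_sum_sqr_deviation (R : realType) :
  (\sum_(k <- index_iota 1 n.+3) deviation n.+1%:R k%:R ^+ 2) @[n --> \oo]
    --> (0 : R).
Proof.
have h0 := @cvg_harmonic R.
apply: (@squeeze_cvgr _ _ _ _ (fun=> 0)
  (fun n => 16 * (harmonic n + harmonic n * harmonic n))).
- apply: nearW => n; rewrite sumr_ge0/=; last by move=> k _; exact: sqr_ge0.
  have x1 : 1 <= n.+1%:R :> R by rewrite ler1n.
  have -> : 16 * (n.+1%:R^-1 + n.+1%:R^-1 * n.+1%:R^-1) =
      \sum_(k <- index_iota 1 n.+3) (4 / n.+1%:R) ^+ 2 :> R.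
    rewrite big_const_seq count_predT size_iota iter_addr_0 subn1 /= -[RHS]mulr_natr.
    have -> : n.+2%:R = n.+1%:R + 1 :> R by rewrite -natr1.
    by move: (n.+1%:R : R) x1 => x x1; field; lra.
  rewrite big_seq [leRHS]big_seq; apply: ler_sum => k.
  rewrite mem_index_iota => /andP[k1 kn].
  have kx : 1 <= (k%:R : R) <= n.+1%:R + 1 by rewrite natr1 ler1n ler_nat k1.
  have /andP[lo hi] := deviation_bounds _ _ _ x1 kx.
  by rewrite -sqrrN lerXn2r ?nnegrE ?oppr_ge0// lerNl.
- exact: cvg_cst.
- rewrite -(mulr0 16) -[X in 16 * X](addr0 0) -[X in 16 * (0 + X)](mulr0 0).
  by apply: cvgMl_tmp; apply: cvgD => //; apply: cvgM.
Qed.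

Theorem lemma18 (R : realType) :
  d R n @[n --> \oo] --> 1 / (expR 1 : R) ^+ 3.
Proof.
rewrite -(cvg_shiftn 2).
have -> : 1 / (expR 1 : R) ^+ 3 = expR (- 3).
  by rewrite expRN div1r -expRM_natl mulr1.
under eq_fun do rewrite addn2 d_deviation.
exact: cvg_prod_1D (@cvg_sum_deviation R) (@cvg_sum_sqr_deviation R).
Qed.
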